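(* $$\frac{7\sqrt2}{8}=\sum_{j=0}^{\infty}\left(\frac14\right)^{j}\frac{\left(\frac12\right)_j\left(\frac54\right)_j\left(\frac32\right)_j}{(1)_j\left(\frac{11}{8}\right)_j\left(\frac{15}{8}\right)_j}\,(j+1).$$
   Context: $(x)_0=1$ and $(x)_j=x(x+1)\cdots(x+j-1)$ for positive integers $j$ (rising factorial). *)

(* Defs.v *)
From Stdlib Require Import Reals.

Open Scope R_scope.

(* rising_factorial x j is (x)_j = x (x + 1) ... (x + j - 1), with (x)_0 = 1. *)
Fixpoint rising_factorial (x : R) (j : nat) : R :=
  match j with
  | O => 1
  | S i => rising_factorial x i * (x + INR i)
  end.

(* Main.v *)
Require Import Defs.
From Stdlib Require Import Reals Lra Psatz.
From Coquelicot Require Import Coquelicot.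
Open Scope R_scope.

(** Write [a_j = (1/2)_j / j!]. Since (11/4)_(2j) = 4^j (11/8)_j (15/8)_j, the
    j-th term of the series is (j + 1) a_j times the ratio of Beta integrals
    B(5/4 + j, 3/2 + j) / B(5/4, 3/2), that is, with x = q^4 and
    y = q^4 (1 - q^4), times M_j / M_0 where
    M_j = int_0^1 4 q^4 sqrt(1 - q^4) y^j dq  ([moment_ratio]).

    The function g = sum a_j y^j is (1 - y)^(-1/2), and sum (j + 1) a_j y^j is
    g + y g'. For every function g of y, the integrand against this sum is,
    up to a total derivative, an integrand against g alone and a multiple of
    (1-y) g' - g/2, which vanishes for g = (1 - y)^(-1/2):

      3 * 4 q^4 sqrt(1-q^4) (g + y g')
        = - d/dq [ sqrt(1-q^4) q (1 - 2 q^4) g ] + (1+q^4)/sqrt(1-q^4) g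
          + 4 q^4 sqrt(1-q^4) ((1-y) g' - g/2).

    Hence the series is 1/(3 M_0) times
    int_0^1 (1+q^4) / (sqrt(1-q^4) sqrt(1-q^4+q^8)) dq. The identity comes from
    the symmetry x -> 1/x, which fixes the point 1 and exchanges the two roots
    of 1 - x + x^2 = 1 - y: its invariant (1 - x)^2 / x is the natural variable.

    The substitution z = q / sqrt(1-q^4) turns this last integral into
    int_0^oo dz / sqrt(1+z^4), and z = sqrt 2 q / sqrt(1-q^4) turns
    sqrt 2 int_0^1 dq / sqrt(1-q^4) into the same one ([RInt_twisted]). As
    M_0 = (8/21) int_0^1 dq / sqrt(1-q^4)  ([moment_0]), the sum is
    (sqrt 2 / 3) (21/8) = 7 sqrt 2 / 8.

    Two devices keep the analysis elementary. The variable is q = sin t with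
    0 <= t <= PI/2, which removes the endpoint singularities: dq / sqrt(1-q^4)
    becomes dt / sqrt(1 + sin^2 t). And g is replaced by the partial sums of
    its series, for which (1-y) g' - g/2 is the single monomial
    - (n + 1/2) a_n y^n ([is_derive_binom_sum]). As 0 <= y <= 1/4, both this
    monomial and the tail of g are geometrically small, uniformly in q
    ([remainder_bound]). *)

(** * The quartic sqrt(1 - q^4) in the variable q = sin t *)

Definition speed (t : R) : R := sqrt (1 + sin t ^ 2).
(** The square root sqrt(1 - q^4), kept in a factored form that is smooth up to
    [t = PI / 2]; see [leg_sqr]. *)
Definition leg (t : R) : R := cos t * speed t.
(** The variable y = x (1 - x) of the power series, for x = q^4. *)
Definition node (t : R) : R := sin t ^ 4 - sin t ^ 8.
(** The Beta density x^(1/4) (1-x)^(1/2) dx, that is 4 q^4 sqrt(1-q^4) dq, with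
    [dq = cos t dt]. *)
Definition weight (t : R) : R := 4 * sin t ^ 4 * cos t * leg t.

Lemma cos_sqr (t : R) : cos t ^ 2 = 1 - sin t ^ 2.
Proof. generalize (sin2_cos2 t); unfold Rsqr; nra. Qed.

Lemma speed_pos (t : R) : 0 < speed t.
Proof. apply sqrt_lt_R0; generalize (pow2_ge_0 (sin t)); lra. Qed.

Lemma speed_sqr (t : R) : speed t ^ 2 = 1 + sin t ^ 2.
Proof. unfold speed; apply pow2_sqrt; generalize (pow2_ge_0 (sin t)); lra. Qed.

Lemma speed_ge1 (t : R) : 1 <= speed t.
Proof.
  generalize (speed_pos t) (speed_sqr t) (pow2_ge_0 (sin t)); nra.
Qed.

Lemma leg_sqr (t : R) : leg t ^ 2 = 1 - sin t ^ 4.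
Proof. unfold leg; rewrite Rpow_mult_distr, cos_sqr, speed_sqr; ring. Qed.

Lemma is_derive_speed (t : R) : is_derive speed t (sin t * cos t / speed t).
Proof.
  unfold speed; auto_derive.
  - generalize (pow2_ge_0 (sin t)); simpl; lra.
  - replace (1 + sin t * (sin t * 1)) with (1 + sin t ^ 2) by ring.
    fold (speed t); field; generalize (speed_pos t); lra.
Qed.

Lemma is_derive_leg (t : R) : is_derive leg t (- 2 * sin t ^ 3 / speed t).
Proof.
  evar_last.
  - unfold leg; apply (is_derive_mult cos speed).
    + apply is_derive_cos.
    + apply is_derive_speed.
    + intros; apply Rmult_comm.
  - assert (H := speed_pos t); unfold plus, mult; simpl.
    transitivity ((- sin t * speed t ^ 2 + sin t * cos t ^ 2) / speed t).
    + field; lra.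
    + rewrite speed_sqr, cos_sqr; field; lra.
Qed.

Lemma is_derive_node (t : R) :
  is_derive node t (4 * sin t ^ 3 * cos t * (1 - 2 * sin t ^ 4)).
Proof. unfold node; auto_derive; [easy | ring]. Qed.

Lemma Derive_leg (t : R) : Derive leg t = - 2 * sin t ^ 3 / speed t.
Proof. apply is_derive_unique, is_derive_leg. Qed.

Lemma node_bounds (t : R) : 0 <= node t <= 1 / 4.
Proof.
  assert (H := pow2_ge_0 (sin t)). assert (H2 := pow2_ge_0 (cos t)).
  rewrite cos_sqr in H2.
  assert (H4 : 0 <= sin t ^ 4 <= 1) by (split; nra).
  unfold node. replace (sin t ^ 8) with (sin t ^ 4 * sin t ^ 4) by ring.
  generalize dependent (sin t ^ 4); intros z Hz.
  generalize (pow2_ge_0 (z - 1 / 2)); split; nra.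
Qed.

Lemma ex_RInt_cont (f : R -> R) a b : (forall x, continuous f x) -> ex_RInt f a b.
Proof. intros H; apply (@ex_RInt_continuous R_CompleteNormedModule); auto. Qed.

Lemma ex_derive_speed t : ex_derive speed t.
Proof. eexists; apply is_derive_speed. Qed.
Lemma ex_derive_leg t : ex_derive leg t.
Proof. eexists; apply is_derive_leg. Qed.
Lemma ex_derive_node t : ex_derive node t.
Proof. eexists; apply is_derive_node. Qed.
Lemma speed_neq0 t : speed t <> 0.
Proof. generalize (speed_pos t); lra. Qed.
#[local] Hint Resolve ex_derive_speed ex_derive_leg ex_derive_node speed_neq0 : core.

Ltac smooth :=
  apply (@ex_derive_continuous R_AbsRing R_NormedModule);
  auto_derive; repeat split; auto.

(** Coquelicot's lemmas leave equations in a module whose carrier is only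
    convertible to [R], a form that [ring] and [field] do not recognise. *)
Ltac in_R := match goal with |- ?a = ?b => change (@eq R a b) end.

(** * Moments of the Beta density *)

Definition moment (j : nat) : R := RInt (fun t => weight t * node t ^ j) 0 (PI / 2).

Lemma is_RInt_moment (j : nat) :
  is_RInt (fun t => weight t * node t ^ j) 0 (PI / 2) (moment j).
Proof.
  apply (@RInt_correct R_CompleteNormedModule), ex_RInt_cont.
  intros x; unfold weight; smooth.
Qed.

(** With [a = 5/4 + j] and [b = 3/2 + j], the function
    x^a (1-x)^b ((a+b) x - b) vanishes at 0 and 1 and its derivative is
    x^(a-1) (1-x)^(b-1) ((a+b)(a+b+1) x (1-x) - a b). *)
Lemma moment_S (j : nat) :
  (11 / 4 + 2 * INR j) * (15 / 4 + 2 * INR j) * moment (S j)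
  = (5 / 4 + INR j) * (3 / 2 + INR j) * moment j.
Proof.
  set (a := 5 / 4 + INR j). set (b := 3 / 2 + INR j).
  assert (H1 : is_RInt
     (fun t => (a + b) * (a + b + 1) * (weight t * node t ^ S j)
               - a * b * (weight t * node t ^ j)) 0 (PI / 2)
     ((a + b) * (a + b + 1) * moment (S j) - a * b * moment j)).
  { apply @is_RInt_minus; apply @is_RInt_scal; apply is_RInt_moment. }
  assert (H2 : is_RInt
     (fun t => (a + b) * (a + b + 1) * (weight t * node t ^ S j)
               - a * b * (weight t * node t ^ j)) 0 (PI / 2) 0).
  { evar_last.
    (* x^a (1-x)^b = y^(j+1) q sqrt(1-q^4) *)
    - apply (is_RInt_derive
        (fun t => node t ^ S j * (sin t * leg t * ((a + b) * sin t ^ 4 - b)))).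
      + intros t _; auto_derive; [repeat split; auto|].
        change (Derive (fun x => leg x) t) with (Derive leg t).
        change (Derive (fun x => node x) t) with (Derive node t).
        rewrite Derive_leg, (is_derive_unique _ _ _ (is_derive_node t)).
        change (Nat.pred (S j)) with j.
        change (match j with 0%nat => 1 | S _ => INR j + 1 end) with (INR (S j)).
        rewrite S_INR. unfold weight.
        assert (HD := speed_pos t).
        change (node t ^ S j) with (node t * node t ^ j).
        generalize (node t ^ j); intro p. unfold a, b, node.
        assert (HC := cos_sqr t). assert (HS := speed_sqr t).
        assert (HL : leg t = cos t * speed t) by reflexivity. rewrite HL.
        field [HC HS]; auto.
      + intros t _; unfold weight; smooth.
    - unfold node, minus, plus, opp; simpl; unfold leg; rewrite cos_PI2, sin_0; ring. }
  generalize (is_RInt_unique _ _ _ _ H1) (is_RInt_unique _ _ _ _ H2).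
  unfold a, b in *; lra.
Qed.

(** The quarter length of the lemniscate, int_0^1 dq / sqrt(1 - q^4). *)
Definition arc : R := RInt (fun t => / speed t) 0 (PI / 2).

Lemma arc_pos : 0 < arc.
Proof.
  apply RInt_gt_0.
  - generalize PI_RGT_0; lra.
  - intros t _; apply Rinv_0_lt_compat, speed_pos.
  - intros t _; smooth.
Qed.

(** The derivative of (4/7 q^5 - 8/21 q) sqrt(1-q^4) is
    4 q^4 sqrt(1-q^4) - (8/21) / sqrt(1-q^4): the two coefficients are chosen to
    match the powers q^8 and q^4 of the numerator. *)
Lemma moment_0 : moment 0 = 8 / 21 * arc.
Proof.
  assert (H1 : is_RInt (fun t => weight t * node t ^ 0 - 8 / 21 * / speed t)
     0 (PI / 2) (moment 0 - 8 / 21 * arc)).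
  { apply @is_RInt_minus; [apply is_RInt_moment|].
    apply @is_RInt_scal, (@RInt_correct R_CompleteNormedModule), ex_RInt_cont.
    intros t; smooth. }
  assert (H2 : is_RInt (fun t => weight t * node t ^ 0 - 8 / 21 * / speed t)
     0 (PI / 2) 0).
  { evar_last.
    - apply (is_RInt_derive
        (fun t => (4 / 7 * sin t ^ 5 - 8 / 21 * sin t) * leg t)).
      + intros t _; auto_derive; [repeat split; auto|].
        change (Derive (fun x => leg x) t) with (Derive leg t).
        rewrite Derive_leg. unfold weight.
        assert (HC := cos_sqr t). assert (HS := speed_sqr t).
        replace (leg t) with (cos t * speed t) by reflexivity.
        simpl (node t ^ 0).
        field [HC HS]; auto.
      + intros t _; unfold weight; smooth.
    - unfold minus, plus, opp; simpl; unfold leg; rewrite cos_PI2, sin_0; ring. }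
  generalize (is_RInt_unique _ _ _ _ H1) (is_RInt_unique _ _ _ _ H2); lra.
Qed.

(** * Partial sums of the binomial series of (1 - y)^(-1/2) *)

Definition coef (j : nat) : R := rising_factorial (1 / 2) j / rising_factorial 1 j.

Lemma rising_factorial_pos (x : R) (j : nat) : 0 < x -> 0 < rising_factorial x j.
Proof.
  intros Hx; induction j; simpl; [lra|].
  generalize (pos_INR j); intros; apply Rmult_lt_0_compat; lra.
Qed.

Lemma coef_S (j : nat) : (INR j + 1) * coef (S j) = (INR j + 1 / 2) * coef j.
Proof.
  unfold coef; simpl; generalize (pos_INR j) (rising_factorial_pos 1 j Rlt_0_1).
  intros; field; lra.
Qed.

Lemma coef_bounds (j : nat) : 0 <= coef j <= 1.
Proof.
  induction j.
  - unfold coef; simpl; lra.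
  - generalize (coef_S j) (pos_INR j); nra.
Qed.

Definition binom_sum (n : nat) (y : R) : R := sum_n (fun j => coef j * y ^ j) n.

Lemma binom_sum_0 (y : R) : binom_sum 0 y = 1.
Proof. unfold binom_sum; rewrite sum_O; unfold coef; simpl; lra. Qed.

Lemma binom_sum_S (n : nat) (y : R) :
  binom_sum (S n) y = binom_sum n y + coef (S n) * y ^ S n.
Proof. unfold binom_sum; rewrite sum_Sn; reflexivity. Qed.

(** The recurrence [coef_S] makes the sum telescope: the equation
    (1-y) g' = g/2 of (1-y)^(-1/2) fails for a partial sum only by its last
    monomial. *)
Lemma is_derive_binom_sum (n : nat) (y : R) : y <> 1 ->
  is_derive (binom_sum n) y
    ((binom_sum n y / 2 - (INR n + 1 / 2) * coef n * y ^ n) / (1 - y)).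
Proof.
  intros Hy; induction n as [|n IH].
  - apply (is_derive_ext (fun _ => 1)).
    + intros t; now rewrite binom_sum_0.
    + evar_last; [apply @is_derive_const|].
      rewrite binom_sum_0; unfold coef, zero; simpl; field; lra.
  - apply (is_derive_ext (fun y => binom_sum n y + coef (S n) * y ^ S n)).
    + intros t; now rewrite binom_sum_S.
    + assert (HP : is_derive (fun y => coef (S n) * y ^ S n) y
                     (coef (S n) * (INR n + 1) * y ^ n)).
      { auto_derive; [easy|]. change (Nat.pred (S n)) with n.
        change (match n with 0%nat => 1 | S _ => INR n + 1 end) with (INR (S n)).
        rewrite S_INR; ring. }
      evar_last; [apply (is_derive_plus _ _ _ _ _ IH HP)|].
      assert (H := coef_S n). change plus with Rplus; cbv beta.
      rewrite binom_sum_S, S_INR, <- H; simpl (y ^ S n); field; lra.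
Qed.

(** This is sum (j + 1) a_j y^j = g + y g', with g' given by
    [is_derive_binom_sum]. *)
Lemma weighted_binom_sum (n : nat) (y : R) : y <> 1 ->
  sum_n (fun j => (INR j + 1) * coef j * y ^ j) n
  = binom_sum n y
    + y * ((binom_sum n y / 2 - (INR n + 1 / 2) * coef n * y ^ n) / (1 - y)).
Proof.
  intros Hy; induction n as [|n IH].
  - rewrite sum_O, binom_sum_0; unfold coef; simpl; field; lra.
  - rewrite sum_Sn, IH, binom_sum_S, S_INR, <- (coef_S n).
    change plus with Rplus; cbv beta; simpl (y ^ S n).
    in_R; field; lra.
Qed.

Lemma ex_derive_binom_sum (n : nat) (y : R) : y <> 1 -> ex_derive (binom_sum n) y.
Proof. intros Hy; eexists; now apply is_derive_binom_sum. Qed.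

(** By the previous equation g sqrt(1-y), which is 1 at 0, has derivative
    - (n + 1/2) a_n y^n / sqrt(1-y); the mean value theorem bounds its distance
    to 1. *)
Lemma binom_sum_approx (n : nat) (y : R) : 0 <= y <= 1 / 4 ->
  Rabs (binom_sum n y - / sqrt (1 - y)) <= 2 * (INR n + 1) * (1 / 4) ^ n.
Proof.
  intros Hy.
  assert (Hs : forall z, z <= 1 / 4 -> 1 / 2 < sqrt (1 - z)).
  { intros z Hz; rewrite <- (sqrt_Rsqr (1 / 2)) by lra.
    apply sqrt_lt_1; unfold Rsqr; lra. }
  assert (HD : forall z, 0 <= z <= 1 / 4 ->
      is_derive (fun z => binom_sum n z * sqrt (1 - z)) z
        (- ((INR n + 1 / 2) * coef n * z ^ n / sqrt (1 - z)))).
  { intros z Hz. specialize (Hs z (proj2 Hz)).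
    auto_derive.
    - repeat split; [apply ex_derive_binom_sum|]; lra.
    - change (Derive (fun x => binom_sum n x) z) with (Derive (binom_sum n) z).
      rewrite (is_derive_unique _ _ _ (is_derive_binom_sum n z ltac:(lra))).
      change (1 + - z) with (1 - z).
      assert (H2 : sqrt (1 - z) ^ 2 = 1 - z) by (apply pow2_sqrt; lra).
      set (r := sqrt (1 - z)) in *. rewrite <- H2; field; lra. }
  destruct (MVT_gen (fun z => binom_sum n z * sqrt (1 - z)) 0 y
    (fun z => - ((INR n + 1 / 2) * coef n * z ^ n / sqrt (1 - z)))) as [c [Hc He]].
  - rewrite Rmin_left, Rmax_right by lra; intros x Hx; apply HD; lra.
  - rewrite Rmin_left, Rmax_right by lra; intros x Hx.
    apply continuity_pt_filterlim.
    apply (ex_derive_continuous (fun z => binom_sum n z * sqrt (1 - z)) x).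
    eexists; apply HD; lra.
  - rewrite Rmin_left, Rmax_right in Hc by lra.
    assert (Hsy := Hs y (proj2 Hy)).
    assert (Hsc := Hs c ltac:(lra)).
    assert (H0 : binom_sum n 0 = 1).
    { clear; induction n; [apply binom_sum_0|].
      rewrite binom_sum_S, IHn, pow_ne_zero by easy; ring. }
    rewrite H0, !Rminus_0_r, sqrt_1 in He.
    assert (Hpow : 0 <= c ^ n <= (1 / 4) ^ n).
    { split; [apply pow_le | apply pow_incr]; lra. }
    assert (Hn := pos_INR n). assert (Ha := coef_bounds n).
    set (K := (INR n + 1 / 2) * coef n * c ^ n) in *.
    assert (HK : 0 <= K <= (INR n + 1) * (1 / 4) ^ n).
    { unfold K; split.
      - apply Rmult_le_pos; [apply Rmult_le_pos|]; lra.
      - apply Rmult_le_compat; [ | lra | | lra].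
        + apply Rmult_le_pos; lra.
        + nra. }
    assert (Hq : 0 <= K / sqrt (1 - c) <= 2 * K).
    { split.
      - apply Rdiv_le_0_compat; lra.
      - apply Rle_div_l; nra. }
    replace (binom_sum n y - / sqrt (1 - y))
      with (- (K / sqrt (1 - c) * y / sqrt (1 - y))).
    + rewrite Rabs_Ropp, Rabs_pos_eq.
      * apply Rle_div_l; [lra|].
        apply Rle_trans with (2 * K * 1 / 4); nra.
      * apply Rdiv_le_0_compat; [apply Rmult_le_pos|]; lra.
    + apply (Rmult_eq_reg_r (sqrt (1 - y))); [|lra].
      transitivity (- (K / sqrt (1 - c)) * y).
      * generalize (K / sqrt (1 - c)); intros q; field; lra.
      * rewrite <- He; field; lra.
Qed.

(** * Two pull-backs of dz / sqrt(1 + z^4) *)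

Definition lemn (x : R) : R := RInt (fun u => / sqrt (1 + u ^ 4)) 0 x.

Lemma pow4_ge0 (u : R) : 0 <= u ^ 4.
Proof. replace (u ^ 4) with ((u ^ 2) ^ 2) by ring; apply pow2_ge_0. Qed.

Lemma continuous_lemn_integrand (u : R) :
  continuous (fun u => / sqrt (1 + u ^ 4)) u.
Proof.
  assert (H := pow4_ge0 u).
  assert (H2 : 0 < sqrt (1 + u ^ 4)) by (apply sqrt_lt_R0; lra).
  smooth; simpl in *; lra.
Qed.

Lemma lemn_le (x y : R) : x <= y -> lemn x <= lemn y.
Proof.
  intros Hxy; unfold lemn.
  rewrite <- (RInt_Chasles (V := R_CompleteNormedModule) _ 0 x y)
    by apply ex_RInt_cont, continuous_lemn_integrand.
  change plus with Rplus; cbv beta.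
  rewrite <- (Rplus_0_r (RInt _ 0 x)) at 1; apply Rplus_le_compat_l, RInt_ge_0; auto.
  - apply ex_RInt_cont, continuous_lemn_integrand.
  - intros u _; apply Rlt_le, Rinv_0_lt_compat, sqrt_lt_R0.
    generalize (pow4_ge0 u); lra.
Qed.

(** The substitution z = q / sqrt(1-q^4), which maps the interval 0 <= t < PI/2
    onto the half-line z >= 0. *)
Definition slope (t : R) : R := sin t / leg t.

Lemma leg_pos (t : R) : 0 <= t < PI / 2 -> 0 < leg t.
Proof.
  intros Ht; apply Rmult_lt_0_compat; [apply cos_gt_0; lra | apply speed_pos].
Qed.

Lemma is_derive_slope (t : R) : 0 <= t < PI / 2 ->
  is_derive slope t ((1 + sin t ^ 4) / (speed t * leg t ^ 2)).
Proof.
  intros Ht; assert (HL := leg_pos t Ht); unfold slope; auto_derive.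
  - repeat split; auto; lra.
  - change (Derive (fun x => leg x) t) with (Derive leg t); rewrite Derive_leg.
    assert (HC := cos_sqr t). assert (HS := speed_sqr t).
    assert (HD := speed_pos t).
    unfold leg in *; field [HC HS]; split; [lra|].
    intro H; rewrite H in HL; lra.
Qed.

(** The integrand (1+q^4) / (sqrt(1-q^4) sqrt(1-q^4+q^8)) dq. *)
Definition twisted (t : R) : R := (1 + sin t ^ 4) / (speed t * sqrt (1 - node t)).

Lemma sqrt_node_ge (t : R) : 1 / 2 <= sqrt (1 - node t).
Proof.
  rewrite <- (sqrt_Rsqr (1 / 2)) by lra.
  apply sqrt_le_1_alt; unfold Rsqr; generalize (node_bounds t); lra.
Qed.

Lemma continuous_twisted (t : R) : continuous twisted t.
Proof.
  assert (H := sqrt_node_ge t). assert (H2 := node_bounds t).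
  unfold twisted; smooth; try lra.
  apply Rmult_integral_contrapositive_currified; auto; unfold Rminus in *; lra.
Qed.

(** The change of variables z = k q / sqrt(1-q^4), for the two values 1 and
    sqrt 2 of [k]. *)
Lemma RInt_lemn (k : R) (f : R -> R) (t : R) :
  0 <= t < PI / 2 ->
  (forall x, 0 <= x <= t ->
     k * ((1 + sin x ^ 4) / (speed x * leg x ^ 2)) * / sqrt (1 + (k * slope x) ^ 4)
     = f x) ->
  RInt f 0 t = lemn (k * slope t).
Proof.
  intros Ht Hf; apply is_RInt_unique.
  apply (is_RInt_ext (fun x =>
    scal (k * ((1 + sin x ^ 4) / (speed x * leg x ^ 2)))
      (/ sqrt (1 + (k * slope x) ^ 4)))).
  - rewrite Rmin_left, Rmax_right by lra; intros x Hx; apply Hf; lra.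
  - evar_last.
    + apply (is_RInt_comp (fun u => / sqrt (1 + u ^ 4)) (fun x => k * slope x)).
      * intros; apply continuous_lemn_integrand.
      * rewrite Rmin_left, Rmax_right by lra; intros x Hx; split.
        -- apply is_derive_scal, is_derive_slope; lra.
        -- assert (HL := leg_pos x ltac:(lra)); smooth.
           apply Rmult_integral_contrapositive_currified; auto; nra.
    + unfold lemn; f_equal; unfold slope; rewrite sin_0; unfold Rdiv; ring.
Qed.

(** For z = q / sqrt(1-q^4), one has 1 + z^4 = (1-q^4+q^8) / (1-q^4)^2. *)
Lemma RInt_twisted_lemn (t : R) : 0 <= t < PI / 2 ->
  RInt twisted 0 t = lemn (slope t).
Proof.
  intros Ht; rewrite <- (Rmult_1_l (slope t)); apply RInt_lemn; auto.
  intros x Hx; assert (HL := leg_pos x ltac:(lra)); assert (HD := speed_pos x).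
  assert (HR := sqrt_node_ge x).
  replace (sqrt (1 + (1 * slope x) ^ 4)) with (sqrt (1 - node x) / leg x ^ 2).
  - unfold twisted; field; lra.
  - rewrite <- (sqrt_pow2 (sqrt (1 - node x) / leg x ^ 2)).
    + f_equal. unfold Rdiv; rewrite Rpow_mult_distr, pow2_sqrt
        by (generalize (node_bounds x); lra).
      assert (HL2 := leg_sqr x). unfold slope, node.
      transitivity ((leg x ^ 2 * leg x ^ 2 + sin x ^ 4) / leg x ^ 4).
      * rewrite HL2 at 2 3; field; lra.
      * field; lra.
    + apply Rdiv_le_0_compat; nra.
Qed.

(** For z = sqrt 2 q / sqrt(1-q^4), the numerator of 1 + z^4 is a square:
    (1-q^4)^2 + 4 q^4 = (1+q^4)^2. *)
Lemma RInt_arc_lemn (t : R) : 0 <= t < PI / 2 ->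
  RInt (fun t => sqrt 2 * / speed t) 0 t = lemn (sqrt 2 * slope t).
Proof.
  intros Ht; apply RInt_lemn; auto.
  intros x Hx; assert (HL := leg_pos x ltac:(lra)); assert (HD := speed_pos x).
  assert (HR := pow4_ge0 (sin x)).
  replace (sqrt (1 + (sqrt 2 * slope x) ^ 4)) with ((1 + sin x ^ 4) / leg x ^ 2).
  - field; repeat split; lra.
  - rewrite <- (sqrt_pow2 ((1 + sin x ^ 4) / leg x ^ 2)).
    + f_equal. rewrite Rpow_mult_distr.
      replace (sqrt 2 ^ 4) with ((sqrt 2 ^ 2) ^ 2) by ring.
      rewrite pow2_sqrt by lra.
      assert (HL2 := leg_sqr x). unfold slope.
      transitivity ((leg x ^ 2 * leg x ^ 2 + 4 * sin x ^ 4) / leg x ^ 4).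
      * rewrite HL2 at 2 3; field; lra.
      * field; lra.
    + apply Rdiv_le_0_compat; nra.
Qed.

(** Halving [cos t] increases [sin t] and multiplies sqrt(1 + sin^2 t) by at
    most sqrt 2, so it multiplies the slope by at least sqrt 2. This replaces
    the limit at infinity of the substitution. *)
Lemma slope_halved (t : R) : 0 <= t < PI / 2 ->
  exists t', 0 <= t' < PI / 2 /\ sqrt 2 * slope t <= slope t'.
Proof.
  intros Ht.
  assert (Hc : 0 < cos t) by (apply cos_gt_0; lra).
  assert (Hc1 := COS_bound t).
  assert (Hs : 0 <= sin t) by (apply sin_ge_0; lra).
  set (t' := acos (cos t / 2)).
  assert (Hct : cos t' = cos t / 2) by (apply cos_acos; lra).
  assert (Hb := acos_bound (cos t / 2)).
  assert (Ht' : 0 <= t' < PI / 2).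
  { split; [apply Hb|]. apply Rnot_le_lt; intro H.
    assert (cos t' <= 0) by (apply cos_le_0; unfold t' in *; lra). lra. }
  exists t'; split; auto.
  assert (Hs' : 0 <= sin t') by (apply sin_ge_0; lra).
  assert (HS := cos_sqr t). assert (HS' := cos_sqr t'). rewrite Hct in HS'.
  assert (Hle : sin t <= sin t') by nra.
  assert (HL := leg_pos t Ht). assert (HL' := leg_pos t' Ht').
  unfold slope.
  assert (H2 : sqrt 2 * leg t' <= leg t).
  { apply Rsqr_incr_0_var; [|lra].
    unfold Rsqr. assert (H := leg_sqr t). assert (H' := leg_sqr t').
    assert (Hq : sqrt 2 ^ 2 = 2) by (apply pow2_sqrt; lra).
    replace (sqrt 2 * leg t' * (sqrt 2 * leg t')) with (sqrt 2 ^ 2 * leg t' ^ 2) by ring.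
    replace (leg t * leg t) with (leg t ^ 2) by ring.
    rewrite Hq, H, H'.
    replace (sin t ^ 4) with ((1 - cos t ^ 2) ^ 2) by (rewrite HS; ring).
    replace (sin t' ^ 4) with ((1 - (cos t / 2) ^ 2) ^ 2) by (rewrite HS'; ring).
    nra. }
  apply Rle_trans with (sqrt 2 * (sin t / (sqrt 2 * leg t'))).
  - apply Rmult_le_compat_l; [apply sqrt_pos|].
    apply Rmult_le_compat_l; auto. apply Rinv_le_contravar; auto.
    apply Rmult_lt_0_compat; auto; apply sqrt_lt_R0; lra.
  - replace (sqrt 2 * (sin t / (sqrt 2 * leg t'))) with (sin t / leg t').
    + apply Rmult_le_compat_r; auto; apply Rlt_le, Rinv_0_lt_compat; auto.
    + field; split; [lra|]. generalize (sqrt_lt_R0 2 ltac:(lra)); lra.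
Qed.

Lemma le_at_endpoint (F : R -> R) (a b M : R) : a < b ->
  continuous F b -> (forall t, a <= t < b -> F t <= M) -> F b <= M.
Proof.
  intros Hab HF H; apply Rnot_lt_le; intro Hlt.
  destruct (HF _ (open_gt M (F b) Hlt)) as [e He].
  assert (Hp := cond_pos e).
  set (t := Rmax a (b - e / 2)).
  assert (Ht : a <= t < b).
  { split; [apply Rmax_l | apply Rmax_lub_lt; lra]. }
  assert (HM : M < F t).
  { apply He. apply Rabs_def1; unfold minus, plus, opp; simpl; [lra|].
    generalize (Rmax_r a (b - e / 2)); fold t; lra. }
  specialize (H t Ht); lra.
Qed.

Lemma RInt_ge0_le (f : R -> R) (a b c : R) : a <= b <= c ->
  (forall x, continuous f x) -> (forall x, 0 <= f x) -> RInt f a b <= RInt f a c.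
Proof.
  intros Hbc Hf H0.
  rewrite <- (RInt_Chasles (V := R_CompleteNormedModule) f a b c)
    by now apply ex_RInt_cont.
  change plus with Rplus; cbv beta.
  rewrite <- (Rplus_0_r (RInt _ a b)) at 1; apply Rplus_le_compat_l, RInt_ge_0; auto.
  - lra.
  - now apply ex_RInt_cont.
Qed.

Lemma continuous_RInt_upper (f : R -> R) (a b : R) :
  (forall x, continuous f x) -> continuous (fun t => RInt f a t) b.
Proof.
  intros Hf; apply (continuous_RInt_1 f a b).
  apply filter_forall; intros z; apply (@RInt_correct R_CompleteNormedModule).
  now apply ex_RInt_cont.
Qed.

Lemma twisted_ge0 (t : R) : 0 <= twisted t.
Proof.
  unfold twisted; apply Rdiv_le_0_compat.
  - generalize (pow4_ge0 (sin t)); lra.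
  - apply Rmult_lt_0_compat; [apply speed_pos|generalize (sqrt_node_ge t); lra].
Qed.

(** Both sides are int_0^oo dz / sqrt(1 + z^4): short of [PI / 2] each integral
    is bounded by the other one taken up to a suitable point, because [lemn] is
    increasing and each substitution reaches the values of the other. *)
Lemma RInt_twisted : RInt twisted 0 (PI / 2) = sqrt 2 * arc.
Proof.
  assert (HPI := PI_RGT_0).
  assert (Hc : forall t, continuous (fun t => sqrt 2 * / speed t) t)
    by (intros t; smooth).
  assert (Hp : forall t, 0 <= sqrt 2 * / speed t).
  { intros t; apply Rmult_le_pos; [apply sqrt_pos|].
    apply Rlt_le, Rinv_0_lt_compat, speed_pos. }
  transitivity (RInt (fun t => sqrt 2 * / speed t) 0 (PI / 2)).
  - apply Rle_antisym.
    + apply (le_at_endpoint (fun t => RInt twisted 0 t) 0 (PI / 2)); [lra| |].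
      * apply continuous_RInt_upper, continuous_twisted.
      * intros t Ht; rewrite RInt_twisted_lemn by auto.
        apply Rle_trans with (lemn (sqrt 2 * slope t)).
        -- apply lemn_le.
           assert (H1 : 1 <= sqrt 2).
           { rewrite <- sqrt_1 at 1; apply sqrt_le_1_alt; lra. }
           assert (H2 : 0 <= slope t).
           { apply Rdiv_le_0_compat; [apply sin_ge_0; lra | now apply leg_pos]. }
           nra.
        -- rewrite <- RInt_arc_lemn by auto; apply RInt_ge0_le; auto; lra.
    + apply (le_at_endpoint (fun t => RInt (fun t => sqrt 2 * / speed t) 0 t) 0 (PI / 2));
        [lra| |].
      * now apply continuous_RInt_upper.
      * intros t Ht; rewrite RInt_arc_lemn by auto.
        destruct (slope_halved t Ht) as [t' [Ht' Hle]].
        apply Rle_trans with (lemn (slope t')); [now apply lemn_le|].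
        rewrite <- RInt_twisted_lemn by auto; apply RInt_ge0_le; try lra.
        -- apply continuous_twisted.
        -- apply twisted_ge0.
  - apply (RInt_scal (V := R_CompleteNormedModule)).
    apply ex_RInt_cont; intros t; smooth.
Qed.

(** * Reduction of the series to the twisted integral *)

Lemma weight_bounds (t : R) : 0 <= weight t <= 4.
Proof.
  assert (Hs := pow4_ge0 (sin t)). assert (HL := leg_sqr t).
  assert (HC := cos_sqr t). assert (HD := speed_pos t).
  assert (H2 := pow2_ge_0 (sin t)).
  assert (Hs1 : sin t ^ 4 <= 1).
  { generalize (pow2_ge_0 (leg t)); lra. }
  assert (H0 : 0 <= cos t * leg t).
  { unfold leg; rewrite <- Rmult_assoc; apply Rmult_le_pos; [apply Rle_0_sqr|lra]. }
  assert (H1 : cos t * leg t <= 1) by (generalize (pow2_ge_0 (cos t - leg t)); nra).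
  unfold weight; rewrite Rmult_assoc; nra.
Qed.

Definition weighted_sum (n : nat) (y : R) : R :=
  sum_n (fun j => (INR j + 1) * coef j * y ^ j) n.

Lemma is_RInt_weighted_sum (n : nat) :
  is_RInt (fun t => weight t * weighted_sum n (node t)) 0 (PI / 2)
    (sum_n (fun j => (INR j + 1) * coef j * moment j) n).
Proof.
  induction n as [|n IH].
  - apply (is_RInt_ext (fun t => (0 + 1) * coef 0 * (weight t * node t ^ 0))).
    + intros t _; unfold weighted_sum; rewrite sum_O; cbn; ring.
    + rewrite sum_O; apply @is_RInt_scal, is_RInt_moment.
  - rewrite sum_Sn.
    apply (is_RInt_ext (fun t => weight t * weighted_sum n (node t)
      + (INR (S n) + 1) * coef (S n) * (weight t * node t ^ S n))).
    + intros t _; unfold weighted_sum; rewrite sum_Sn.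
      change plus with Rplus; cbv beta.
      in_R; ring.
    + apply @is_RInt_plus; [exact IH|].
      apply @is_RInt_scal, is_RInt_moment.
Qed.

(** The function under the total derivative in the reduction; it vanishes at both
    ends, through [sin] at 0 and [leg] at [PI / 2]. *)
Definition boundary (n : nat) (t : R) : R :=
  - (leg t * sin t * (1 - 2 * sin t ^ 4) * binom_sum n (node t)).

Lemma ex_derive_binom_sum_node (n : nat) (t : R) :
  ex_derive (fun x => binom_sum n x) (node t).
Proof. apply ex_derive_binom_sum; generalize (node_bounds t); lra. Qed.
#[local] Hint Resolve ex_derive_binom_sum_node : core.

(** The coefficients of g' agree because 3 y + (1 - 2 q^4)^2 = 1 - y. *)
Lemma is_derive_boundary (n : nat) (t : R) :
  is_derive (boundary n) t
    (3 * (weight t * weighted_sum n (node t))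
     - (1 + sin t ^ 4) / speed t * binom_sum n (node t)
     + weight t * ((INR n + 1 / 2) * coef n * node t ^ n)).
Proof.
  assert (Hy := node_bounds t).
  unfold weighted_sum; rewrite weighted_binom_sum by lra.
  unfold boundary; auto_derive; [repeat split; auto|].
  change (Derive (fun x => leg x) t) with (Derive leg t).
  change (Derive (fun x => node x) t) with (Derive node t).
  change (Derive (fun x => binom_sum n x) (node t)) with (Derive (binom_sum n) (node t)).
  rewrite Derive_leg, (is_derive_unique _ _ _ (is_derive_node t)).
  rewrite (is_derive_unique _ _ _ (is_derive_binom_sum n (node t) ltac:(lra))).
  assert (HC := cos_sqr t). assert (HS := speed_sqr t).
  generalize (binom_sum n (node t)) ((INR n + 1 / 2) * coef n * node t ^ n).
  intros b e. unfold weight.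
  replace (leg t) with (cos t * speed t) by reflexivity.
  unfold node in *.
  field [HC HS]; split; auto; lra.
Qed.

Definition remainder (n : nat) (t : R) : R :=
  (1 + sin t ^ 4) / speed t * (binom_sum n (node t) - / sqrt (1 - node t))
  - weight t * ((INR n + 1 / 2) * coef n * node t ^ n).

Lemma is_RInt_remainder (n : nat) :
  is_RInt (remainder n) 0 (PI / 2)
    (3 * sum_n (fun j => (INR j + 1) * coef j * moment j) n - sqrt 2 * arc).
Proof.
  set (s := sum_n _ n).
  assert (HB : is_RInt (fun t => 3 * (weight t * weighted_sum n (node t))
     - (1 + sin t ^ 4) / speed t * binom_sum n (node t)
     + weight t * ((INR n + 1 / 2) * coef n * node t ^ n)) 0 (PI / 2) 0).
  { evar_last.
    - apply (is_RInt_derive (boundary n)); intros t _.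
      + apply is_derive_boundary.
      + apply (continuous_ext (fun t =>
          3 * (weight t * (binom_sum n (node t)
    + node t * ((binom_sum n (node t) / 2 - (INR n + 1 / 2) * coef n * node t ^ n)
       / (1 - node t))))
          - (1 + sin t ^ 4) / speed t * binom_sum n (node t)
          + weight t * ((INR n + 1 / 2) * coef n * node t ^ n))).
        * intros x; unfold weighted_sum; rewrite weighted_binom_sum; auto.
          generalize (node_bounds x); lra.
        * unfold weight; smooth. generalize (node_bounds t); lra.
    - unfold boundary, leg, minus, plus, opp; simpl; rewrite cos_PI2, sin_0; ring. }
  apply (is_RInt_ext (fun t => 3 * (weight t * weighted_sum n (node t)) - twisted t
    - (3 * (weight t * weighted_sum n (node t))
     - (1 + sin t ^ 4) / speed t * binom_sum n (node t)
     + weight t * ((INR n + 1 / 2) * coef n * node t ^ n)))).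
  - intros t _; unfold remainder, twisted.
    assert (H := sqrt_node_ge t).
    in_R; field; split; auto; lra.
  - replace (3 * s - sqrt 2 * arc) with (3 * s - sqrt 2 * arc - 0) by ring.
    apply @is_RInt_minus; [|exact HB]. apply @is_RInt_minus.
    + apply @is_RInt_scal, is_RInt_weighted_sum.
    + rewrite <- RInt_twisted; apply (@RInt_correct R_CompleteNormedModule).
      apply ex_RInt_cont, continuous_twisted.
Qed.

Lemma remainder_bound (n : nat) (t : R) :
  Rabs (remainder n t) <= 8 * ((INR n + 1) * (1 / 4) ^ n).
Proof.
  assert (Hy := node_bounds t). assert (Hb := binom_sum_approx n (node t) Hy).
  assert (Hw := weight_bounds t). assert (Hn := pos_INR n).
  assert (Ha := coef_bounds n). assert (HD := speed_ge1 t).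
  assert (Hpow : 0 <= node t ^ n <= (1 / 4) ^ n).
  { split; [apply pow_le | apply pow_incr]; lra. }
  assert (Hs : 0 <= (1 + sin t ^ 4) / speed t <= 2).
  { assert (H4 := pow4_ge0 (sin t)).
    assert (HL := leg_sqr t). assert (H5 := pow2_ge_0 (leg t)).
    split; [apply Rdiv_le_0_compat | apply Rle_div_l]; lra. }
  assert (Hc : 0 <= (INR n + 1 / 2) * coef n <= INR n + 1).
  { split; [apply Rmult_le_pos; lra|].
    apply Rle_trans with ((INR n + 1 / 2) * 1); [apply Rmult_le_compat_l|]; lra. }
  unfold remainder, Rminus at 1.
  eapply Rle_trans; [apply Rabs_triang|].
  rewrite Rabs_Ropp, !Rabs_mult.
  rewrite (Rabs_pos_eq ((1 + sin t ^ 4) / speed t)) by lra.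
  rewrite (Rabs_pos_eq (weight t)) by lra.
  rewrite <- (Rabs_mult (INR n + 1 / 2)), (Rabs_pos_eq (_ * coef n)) by lra.
  rewrite (Rabs_pos_eq (node t ^ n)) by lra.
  assert (H1 : (1 + sin t ^ 4) / speed t
     * Rabs (binom_sum n (node t) - / sqrt (1 - node t))
     <= 2 * (2 * (INR n + 1) * (1 / 4) ^ n)).
  { apply Rmult_le_compat; try lra; apply Rabs_pos. }
  assert (H2 : weight t * ((INR n + 1 / 2) * coef n * node t ^ n)
     <= 4 * ((INR n + 1) * (1 / 4) ^ n)).
  { apply Rmult_le_compat; try lra; [apply Rmult_le_pos; lra|].
    apply Rmult_le_compat; lra. }
  lra.
Qed.

Lemma linear_geom_le (n : nat) : (INR n + 1) * (1 / 4) ^ n <= (1 / 2) ^ n.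
Proof.
  induction n as [|n IH]; [simpl; lra|].
  assert (H := pos_INR n). rewrite S_INR; simpl.
  assert (H4 : 0 < (1 / 4) ^ n) by (apply pow_lt; lra). nra.
Qed.

Lemma is_series_moment :
  is_series (fun j => (INR j + 1) * coef j * moment j) (sqrt 2 * arc / 3).
Proof.
  set (u := sum_n (fun j => (INR j + 1) * coef j * moment j)).
  assert (Hu : forall n, Rabs (u n - sqrt 2 * arc / 3) <= PI * 4 / 3 * (1 / 2) ^ n).
  { intros n.
    assert (HP := PI_RGT_0).
    assert (H : Rabs (3 * u n - sqrt 2 * arc)
      <= (PI / 2 - 0) * (8 * ((INR n + 1) * (1 / 4) ^ n))).
    { apply (norm_RInt_le_const (V := R_NormedModule) (remainder n)); [lra| |].
      - intros t _; apply remainder_bound.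
      - apply is_RInt_remainder. }
    replace (u n - sqrt 2 * arc / 3) with (/ 3 * (3 * u n - sqrt 2 * arc)) by field.
    rewrite Rabs_mult, Rabs_pos_eq by lra.
    assert (Hg := linear_geom_le n).
    nra. }
  assert (Hg : is_lim_seq (fun n => PI * 4 / 3 * (1 / 2) ^ n) 0).
  { replace (Finite 0) with (Rbar_mult (PI * 4 / 3) 0)
      by (simpl; f_equal; ring).
    apply is_lim_seq_scal_l, is_lim_seq_geom; rewrite Rabs_pos_eq; lra. }
  change (is_lim_seq u (sqrt 2 * arc / 3)).
  apply (is_lim_seq_ext (fun n => (u n - sqrt 2 * arc / 3) + sqrt 2 * arc / 3)).
  { intros n; ring. }
  replace (Finite (sqrt 2 * arc / 3)) with (Finite (0 + sqrt 2 * arc / 3))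
    by (f_equal; ring).
  apply is_lim_seq_plus'; [|apply is_lim_seq_const].
  apply is_lim_seq_abs_0.
  apply (is_lim_seq_le_le (fun _ => 0) _ (fun n => PI * 4 / 3 * (1 / 2) ^ n)); auto.
  - intros n; split; [apply Rabs_pos | apply Hu].
  - apply is_lim_seq_const.
Qed.

(** The factor [(1/4)^j] splits (11/4)_(2j), which the moment recurrence
    produces, into (11/8)_j (15/8)_j. *)
Lemma moment_ratio (j : nat) :
  (1 / 4) ^ j * (rising_factorial (5 / 4) j * rising_factorial (3 / 2) j)
    / (rising_factorial (11 / 8) j * rising_factorial (15 / 8) j) * moment 0
  = moment j.
Proof.
  induction j as [|j IH]; [simpl; field|].
  assert (H := moment_S j). assert (Hj := pos_INR j).
  assert (H1 := rising_factorial_pos (11 / 8) j ltac:(lra)).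
  assert (H2 := rising_factorial_pos (15 / 8) j ltac:(lra)).
  apply (Rmult_eq_reg_l ((11 / 4 + 2 * INR j) * (15 / 4 + 2 * INR j))); [|nra].
  rewrite H, <- IH; simpl; field; repeat split; lra.
Qed.

Theorem mainTheorem18 :
  is_series
    (fun j : nat =>
       (1 / 4) ^ j *
       ((rising_factorial (1 / 2) j * rising_factorial (5 / 4) j *
         rising_factorial (3 / 2) j) /
        (rising_factorial 1 j * rising_factorial (11 / 8) j *
         rising_factorial (15 / 8) j)) *
       (INR j + 1))
    (7 * sqrt 2 / 8).
Proof.
  assert (HA := arc_pos). assert (H0 := moment_0).
  apply (is_series_ext (fun j => / moment 0 * ((INR j + 1) * coef j * moment j))).
  - intros j; rewrite <- (moment_ratio j); unfold coef.
    assert (H1 := rising_factorial_pos (11 / 8) j ltac:(lra)).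
    assert (H2 := rising_factorial_pos (15 / 8) j ltac:(lra)).
    assert (H3 := rising_factorial_pos 1 j ltac:(lra)).
    in_R; field; repeat split; lra.
  - replace (7 * sqrt 2 / 8) with (/ moment 0 * (sqrt 2 * arc / 3))
      by (rewrite H0; field; lra).
    exact (is_series_scal_l (/ moment 0) _ _ is_series_moment).
Qed.
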